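(* If $G$ is a finitely generated group, then $G_{bound}$ is a subgroup of $FC(G)$.
   Context: For a finitely generated group $G$, a finite generating set $S$ of $G$ and $g\in G$, the word-length $l_S(g)$ is the minimal integer $n\ge 0$ such that $g$ is a product of $n$ elements of $S\cup S^{-1}$. $G_{bound}$ denotes the set of all $g\in G$ for which there exists a constant $M>0$ such that $l_S(g)<M$ for every finite generating set $S$ of $G$. $FC(G)$, the FC-center of $G$, is the subgroup of elements of $G$ that have only finitely many conjugates in $G$. *)

(* Defs.v *)
From HB Require Import structures.
From mathcomp Require Import all_boot.
From mathcomp Require Import mathcomp_extra boolp classical_sets functions.
From mathcomp Require Import cardinality.

Set Implicit Arguments.
Unset Strict Implicit.
Unset Printing Implicit Defensive.

Local Open Scope classical_set_scope.
Local Open Scope group_scope.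

(* Groups are the possibly infinite [groupType]s of monoid.v, and subsets of
   them are classical sets.  The [choiceType] carried by a [groupType] is no
   restriction, since the axioms of boolp put one on every type. *)

Section BoundedElements.
Variable G : groupType.
Implicit Types (S H : set G) (g x y : G) (w : seq G) (n : nat).

Definition subgroup H : Prop := group_closed (mem H).

Definition generates S : Prop := smallest subgroup S = [set: G].

Definition finite_generating S : Prop := finite_set S /\ generates S.

Definition symm S : set G := S `|` [set x^-1 | x in S].

Definition word_of_size S g n : Prop :=
  exists w, [/\ size w = n, [set` w] `<=` symm S & \prod_(x <- w) x = g].

(* The default 0 is taken only when no word over [symm S] represents g, which
   [word_lengthP] excludes as soon as S generates G. *)
Definition word_length S g : nat :=
  xget 0%N [set n | word_of_size S g n /\
                    forall m, word_of_size S g m -> (n <= m)%N].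

Definition Gbound : set G :=
  [set g | exists2 M : nat, (0 < M)%N &
           forall S, finite_generating S -> (word_length S g < M)%N].

Definition FC : set G :=
  [set g | finite_set [set g ^ y | y in [set: G]]].

Lemma subgroup_words S : subgroup [set g | exists n, word_of_size S g n].
Proof.
have symmV x : symm S x -> symm S x^-1.
  by case=> [Sx|[z Sz <-]]; [right; exists x|left; rewrite invgK].
split=> [|x y]; first by rewrite inE; exists 0%N, [::]; rewrite big_nil.
rewrite !inE => -[_ [w1 [_ Sw1 <-]]] [_ [w2 [_ Sw2 <-]]].
exists (size (w1 ++ [seq z^-1 | z <- rev w2])).
exists (w1 ++ [seq z^-1 | z <- rev w2]); split=> //.
  move=> z /=; rewrite mem_cat => /orP[/Sw1//|/mapP[t]].
  by rewrite mem_rev => /Sw2 /symmV St ->.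
rewrite big_cat /= big_map; congr (_ * _).
elim: w2 {Sw2} => [|z w IHw]; first by rewrite !big_nil invg1.
by rewrite rev_cons -cats1 big_cat big_seq1 IHw big_cons invgM.
Qed.

Lemma word_lengthP S g : generates S ->
  word_of_size S g (word_length S g) /\
  forall m, word_of_size S g m -> (word_length S g <= m)%N.
Proof.
move=> genS; have [n Sn] : exists n, word_of_size S g n.
  have : [set: G] g by [].
  rewrite -genS; apply: (smallest_sub (subgroup_words S)) => x Sx.
  exists 1%N, [:: x]; rewrite big_seq1; split=> // z /=.
  by rewrite inE => /eqP->; left.
have exP : exists m, `[< word_of_size S g m >] by exists n; apply/asboolP.
pose least := [set n | word_of_size S g n /\
                       forall m, word_of_size S g m -> (n <= m)%N].
suff /(xgetPex 0%N) : exists m, least m by [].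
case: (ex_minnP exP) => m /asboolP Sm minm; exists m; split=> // k Sk.
exact/minm/asboolP.
Qed.

Lemma subgroup_FC : subgroup FC.
Proof.
split=> [|x y].
  rewrite inE; apply: sub_finite_set (finite_set1 (1 : G)) => _ [y _ <-] /=.
  by rewrite conj1g.
rewrite !inE => fx fy.
apply: sub_finite_set (finite_image2 (fun a b => a / b) fx fy) => _ [z _ <-].
by exists (x ^ z); [exists z|exists (y ^ z); [exists z|rewrite conjMg conjVg]].
Qed.

End BoundedElements.

Arguments Gbound G : clear implicits.
Arguments FC G : clear implicits.

(* Main.v *)
Require Import Defs.
From HB Require Import structures.
From mathcomp Require Import all_boot.
From mathcomp Require Import mathcomp_extra boolp classical_sets functions.
From mathcomp Require Import cardinality.

(** Conjugating a finite generating set S by y gives another finite generating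
    set, and the length of g over it is the length over S of a conjugate of g.
    As y varies, every conjugate of g is reached while S stays fixed.  A bound
    on the lengths of g over all finite generating sets therefore puts the whole
    conjugacy class of g in one ball for S ([word_length_conj_preimage]), and
    balls are finite ([finite_ball]).

    That the bounded elements form a subgroup is the subadditivity of word
    length, [word_length_div]. *)

Local Open Scope classical_set_scope.

Section WordLength.
Set Implicit Arguments.
Unset Strict Implicit.
Local Open Scope group_scope.
Variable G : groupType.
Implicit Types (S H : set G) (g x y : G) (n : nat).

Lemma symmV S x : symm S x -> symm S x^-1.
Proof. by case=> [Sx|[z Sz <-]]; [right; exists x|left; rewrite invgK]. Qed.

Lemma finite_symm S : finite_set S -> finite_set (symm S).
Proof. by move=> fS; rewrite finite_setU; split=> //; apply: finite_image. Qed.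

Lemma word_of_size_mul S x y m n :
  word_of_size S x m -> word_of_size S y n -> word_of_size S (x * y) (m + n).
Proof.
move=> [w1 [<- Sw1 <-]] [w2 [<- Sw2 <-]]; exists (w1 ++ w2).
split; [by rewrite size_cat| |by rewrite big_cat].
by move=> z /=; rewrite mem_cat => /orP[/Sw1|/Sw2].
Qed.

Lemma word_of_size_inv S x n : word_of_size S x n -> word_of_size S x^-1 n.
Proof.
move=> [w [<- Sw <-]]; exists [seq z^-1 | z <- rev w].
split; first by rewrite size_map size_rev.
  by move=> z /= /mapP[t]; rewrite mem_rev => /Sw /symmV St ->.
rewrite big_map; elim: w {Sw} => [|z w IHw]; first by rewrite !big_nil invg1.
by rewrite rev_cons -cats1 big_cat big_seq1 IHw big_cons invgM.
Qed.

Lemma word_length_div S x y : generates S ->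
  (word_length S (x / y) <= word_length S x + word_length S y)%N.
Proof.
move=> genS; have [_] := word_lengthP (x / y) genS; apply.
apply: word_of_size_mul; first exact: (word_lengthP x genS).1.
by apply/word_of_size_inv; exact: (word_lengthP y genS).1.
Qed.

Lemma word_length1 S : generates S -> word_length S 1 = 0%N.
Proof.
move=> genS; have [_ /(_ 0%N)] := word_lengthP 1 genS.
rewrite leqn0 => le0; apply/eqP/le0.
by exists [::]; rewrite big_nil.
Qed.

(** A word of size n.+1 is a letter of the finite set [symm S] followed by a
    word of size n. *)
Lemma finite_word_of_size S n :
  finite_set S -> finite_set [set g | word_of_size S g n].
Proof.
move=> /finite_symm fS; elim: n => [|n IHn].
  apply: sub_finite_set (finite_set1 (1 : G)) => _ [w [/size0nil-> _ <-]].
  by rewrite big_nil.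
apply: sub_finite_set (finite_image2 (fun a b => a * b) fS IHn).
move=> _ [[|z w] [//= [sz_w] Sw <-]]; rewrite big_cons.
exists z; first by apply: Sw; rewrite /= mem_head.
exists (\prod_(x <- w) x) => //; exists w; split=> // t /= wt.
by apply: Sw; rewrite /= inE wt orbT.
Qed.

Lemma finite_ball S n : finite_set S -> generates S ->
  finite_set [set g | (word_length S g < n)%N].
Proof.
move=> fS genS.
apply: (@sub_finite_set _ _ (\bigcup_(k in `I_n) [set g | word_of_size S g k])).
  by move=> g /= ltgn; exists (word_length S g); [|case: (word_lengthP g genS)].
by apply: bigcup_finite => // k _; apply: finite_word_of_size.
Qed.

(** The conjugate of S by y^-1, taken as a preimage so that membership in it
    unfolds to membership in S without an existential. *)
Definition conj_preimage S y : set G := [set z | S (z ^ y)].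

Lemma subgroup_conj_preimage H y : subgroup H -> subgroup (conj_preimage H y).
Proof.
move=> [H1 Hdiv]; split=> [|a b].
  by move: H1; rewrite !inE /conj_preimage /= conj1g.
move: (Hdiv (a ^ y) (b ^ y)); rewrite !inE /conj_preimage /= conjMg conjVg.
exact.
Qed.

(** For H a subgroup containing the conjugate of S by y^-1, the conjugate of H
    by y is a subgroup containing S, hence is all of G, and so is H. *)
Lemma finite_generating_conj_preimage S y :
  finite_generating S -> finite_generating (conj_preimage S y).
Proof.
move=> [fS genS]; split.
  by apply: finite_preimage fS => a b _ _; apply: conjg_inj.
apply/seteqP; split=> // g _ H [sgH SyH].
have : [set: G] (g ^ y) by [].
rewrite -genS => /(_ (conj_preimage H y^-1)); rewrite /conj_preimage /= conjgK.
apply; split; first exact: subgroup_conj_preimage.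
by move=> x Sx; apply: SyH; rewrite /conj_preimage /= conjgKV.
Qed.

Lemma symm_conj_preimage S x y :
  symm (conj_preimage S y) x -> symm S (x ^ y).
Proof.
case=> [|[z Sz <-]]; first by left.
by right; exists (z ^ y); rewrite ?conjVg.
Qed.

Lemma word_of_size_conj_preimage S g y n :
  word_of_size (conj_preimage S y) g n -> word_of_size S (g ^ y) n.
Proof.
move=> [w [<- Sw <-]]; exists [seq x ^ y | x <- w].
split; first by rewrite size_map.
  by move=> _ /mapP[x /Sw Sx ->]; apply: symm_conj_preimage.
rewrite big_map; elim: w {Sw} => [|x w IHw]; first by rewrite !big_nil conj1g.
by rewrite !big_cons IHw conjMg.
Qed.

(** Conjugation by y carries words over the conjugated set to words over S
    letter by letter. *)
Lemma word_length_conj_preimage S g y : finite_generating S ->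
  (word_length S (g ^ y) <= word_length (conj_preimage S y) g)%N.
Proof.
move=> fgS; have [_ genSy] := finite_generating_conj_preimage y fgS.
have [_] := word_lengthP (g ^ y) fgS.2; apply.
exact/word_of_size_conj_preimage/(word_lengthP g genSy).1.
Qed.

Lemma subgroup_Gbound : subgroup (Gbound G).
Proof.
split=> [|x y]; first by rewrite inE; exists 1%N => // S [_ /word_length1->].
rewrite !inE => -[M M_gt0 ltxM] [N N_gt0 ltyN].
exists (M + N)%N; first by rewrite addn_gt0 M_gt0.
move=> S fgS; apply: leq_ltn_trans (word_length_div x y fgS.2) _.
by rewrite -addSn leq_add ?ltxM// ltnW ?ltyN.
Qed.

Lemma Gbound_sub_FC :
  (exists S : set G, finite_generating S) -> Gbound G `<=` FC G.
Proof.
move=> [S fgS] g [M _ ltgM]; case: (fgS) => fS genS.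
apply: sub_finite_set (finite_ball M fS genS) => _ [y _ <-] /=.
apply: leq_ltn_trans (word_length_conj_preimage g y fgS) _.
exact/ltgM/finite_generating_conj_preimage.
Qed.

End WordLength.

Theorem corollary2p6 (G : groupType)
    (fgG : exists S : set G, finite_generating S) :
  subgroup (Gbound G) /\ Gbound G `<=` FC G.
Proof. by split; [exact: subgroup_Gbound|exact: Gbound_sub_FC]. Qed.
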